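(* There exists a polynomial-time offline algorithm that, given a stable matching instance with one-sided uncertainty (with full knowledge of all preferences) and its $B$-optimal stable matching $M$, computes a set of $\mathcal{O}(n)$ set queries whose answers verify that $M$ is stable and $B$-optimal.
   Context: Two disjoint sets $A$, $B$ of agents with $|A|=|B|=n$. Each $a\in A$ has a strict total order $\prec_a$ on $B$ and each $b\in B$ has a strict total order $\prec_b$ on $A$ ($x\prec_y z$: $y$ prefers $x$ to $z$). A matching is a bijection between $A$ and $B$; it is stable if there is no pair $(a,b)$, $b\neq M(a)$, with $a$ preferring $b$ to $M(a)$ and $b$ preferring $a$ to $M(b)$. A stable matching is $B$-optimal if every agent of $B$ weakly prefers its partner in it to its partner in any other stable matching. One-sided uncertainty: the orders $\prec_a$ ($a\in A$) are known to a verifier, the orders $\prec_b$ ($b\in B$) only through queries. A set query $\mathit{top}(b,S)$ for $b\in B$ and $S\subseteq A$ returns $b$'s most preferred element of $S$. A query set verifies the property if, for every $B$-side preference profile consistent with the $A$-side preferences and the answers, $M$ is stable and $B$-optimal. *)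

(* Defs.v *)
From mathcomp Require Import all_boot all_fingroup.

Set Implicit Arguments.
Unset Strict Implicit.
Unset Printing Implicit Defensive.

(** * Stable matching with one-sided uncertainty *)

(* Both sides have [n] agents, and each side is labelled by ['I_n].  The two
   copies of ['I_n] play the roles of disjoint sets: A-agents are the arguments
   of a matching [M], B-agents its values. *)

Definition strict_order (T : eqType) (r : rel T) : Prop :=
  [/\ irreflexive r, transitive r & forall x y, x != y -> r x y || r y x].

(* [P y x z] reads "y prefers x to z" (x comes before z in y's order). *)
Definition profile (n : nat) : Type := 'I_n -> rel 'I_n.

Definition strict_profile n (P : profile n) : Prop :=
  forall y, strict_order (P y).

Definition partnerA n (M : {perm 'I_n}) (a : 'I_n) : 'I_n := M a.
Definition partnerB n (M : {perm 'I_n}) (b : 'I_n) : 'I_n := (M^-1)%g b.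

Definition stable n (PA PB : profile n) (M : {perm 'I_n}) : Prop :=
  ~ exists a b, [/\ b != partnerA M a,
                    PA a b (partnerA M a) & PB b a (partnerB M b)].

Definition weakly_prefers n (P : profile n) (y x z : 'I_n) : Prop :=
  x = z \/ P y x z.

Definition B_optimal n (PA PB : profile n) (M : {perm 'I_n}) : Prop :=
  stable PA PB M /\
  forall M', stable PA PB M' ->
  forall b, weakly_prefers PB b (partnerB M b) (partnerB M' b).

(** * Set queries *)

(* [(b, S)] is the query top(b, S). *)
Definition query (n : nat) : Type := ('I_n * {set 'I_n})%type.

(* For a strict profile the answer is [Some] of the unique best element of [S]
   when [S] is nonempty; a query with [S] empty is answered [None] under every
   profile and so carries no information. *)
Definition top n (PB : profile n) (q : query n) : option 'I_n :=
  [pick x in q.2 | [forall y in q.2, (y != x) ==> PB q.1 x y]].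

(* [PB'] gives the same answers to the queries [qs] as the true profile [PB]. *)
Definition consistent n (PB : profile n) (qs : seq (query n))
    (PB' : profile n) : Prop :=
  forall q, q \in qs -> top PB' q = top PB q.

Definition verifies_B_optimal n (PA PB : profile n) (M : {perm 'I_n})
    (qs : seq (query n)) : Prop :=
  forall PB' : profile n, strict_profile PB' -> consistent PB qs PB' ->
  stable PA PB' M /\ B_optimal PA PB' M.

(** * Algorithms: structured programs for a random access machine *)

(* The machine has registers, a memory with indirect addressing and a
   write-only output tape, all holding natural numbers.  Its only
   value-increasing operation is addition, so after [t] steps every stored
   value has at most [t] more bits than the largest number among the input, the
   input length and the constants of the program.  Hence running time up to a
   polynomial is the same under the unit-cost measure below, under bit cost,
   and on Turing machines; this would fail if multiplication had unit cost. *)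

Inductive binop := Plus | Minus | Eq | Lt.

Inductive expr :=
| Const of nat
| Reg of nat
| Fetch of expr
| Bin of binop & expr & expr.

Inductive prog :=
| Skip
| Assign of nat & expr
| Store of expr & expr
| Emit of expr
| Then of prog & prog
| If of expr & prog & prog
| While of expr & prog.

Record state := State {
  regs : nat -> nat;
  mem : nat -> nat;
  out : seq nat
}.

Definition update (f : nat -> nat) (i v : nat) : nat -> nat :=
  fun j => if j == i then v else f j.

Definition eval_binop (o : binop) (x y : nat) : nat :=
  match o with
  | Plus => x + y
  | Minus => x - y
  | Eq => (x == y)
  | Lt => (x < y)
  end.

Fixpoint eval (s : state) (e : expr) : nat :=
  match e with
  | Const k => k
  | Reg r => regs s r
  | Fetch e1 => mem s (eval s e1)
  | Bin o e1 e2 => eval_binop o (eval s e1) (eval s e2)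
  end.

Fixpoint expr_cost (e : expr) : nat :=
  match e with
  | Const _ | Reg _ => 1
  | Fetch e1 => (expr_cost e1).+1
  | Bin _ e1 e2 => (expr_cost e1 + expr_cost e2).+1
  end.

(* [exec c s t s']: started in [s], the program [c] halts in [s'] after [t]
   steps.  Tests regard 0 as false and every other value as true. *)
Inductive exec : prog -> state -> nat -> state -> Prop :=
| ExecSkip s : exec Skip s 1 s
| ExecAssign r e s :
    exec (Assign r e) s (expr_cost e).+1
         (State (update (regs s) r (eval s e)) (mem s) (out s))
| ExecStore e1 e2 s :
    exec (Store e1 e2) s (expr_cost e1 + expr_cost e2).+1
         (State (regs s) (update (mem s) (eval s e1) (eval s e2)) (out s))
| ExecEmit e s :
    exec (Emit e) s (expr_cost e).+1
         (State (regs s) (mem s) (rcons (out s) (eval s e)))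
| ExecThen c1 c2 s t1 s1 t2 s2 :
    exec c1 s t1 s1 -> exec c2 s1 t2 s2 ->
    exec (Then c1 c2) s (t1 + t2) s2
| ExecIfTrue e c1 c2 s t s' :
    eval s e != 0 -> exec c1 s t s' ->
    exec (If e c1 c2) s (expr_cost e + t).+1 s'
| ExecIfFalse e c1 c2 s t s' :
    eval s e = 0 -> exec c2 s t s' ->
    exec (If e c1 c2) s (expr_cost e + t).+1 s'
| ExecWhileTrue e c s t1 s1 t2 s2 :
    eval s e != 0 -> exec c s t1 s1 -> exec (While e c) s1 t2 s2 ->
    exec (While e c) s (expr_cost e + t1 + t2).+1 s2
| ExecWhileFalse e c s :
    eval s e = 0 -> exec (While e c) s (expr_cost e).+1 s.

Definition init_state (input : seq nat) : state :=
  State (fun=> 0) (nth 0 input) [::].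

(* [exec] is deterministic, so the output and the time are unique. *)
Definition computes (c : prog) (input output : seq nat) (t : nat) : Prop :=
  exists2 s, exec c (init_state input) t s & out s = output.

(** * Encodings *)

(* An order as the list of all agents, most preferred first.  The reflexive
   closure is used because [sort] expects a total relation. *)
Definition pref_list n (r : rel 'I_n) : seq nat :=
  [seq val x | x <- sort (fun x z => (x == z) || r x z) (enum 'I_n)].

Definition encode_profile n (P : profile n) : seq nat :=
  flatten [seq pref_list (P y) | y <- enum 'I_n].

Definition encode_instance n (PA PB : profile n) (M : {perm 'I_n}) : seq nat :=
  n :: encode_profile PA ++ encode_profile PB
    ++ [seq val (partnerA M a) | a <- enum 'I_n].

(* A query (b, S) is output as b followed by the [n] bits of the characteristic
   vector of S. *)
Definition encode_query n (q : query n) : seq nat :=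
  val q.1 :: [seq (a \in q.2 : nat) | a <- enum 'I_n].

Definition encode_queries n (qs : seq (query n)) : seq nat :=
  flatten [seq encode_query q | q <- qs].

(* Main.v *)
(*
   Call b an admirer of a if b prefers a to its partner in M, and let next(a) be
   the admirer of a that a ranks highest (if there is one).  As M is stable, all
   admirers of a come after M(a) in the order of a.  The queries are
   - for each b, top(b, {a | no admirer of a is ranked at b or above by a}),
     answered by the partner of b;
   - for each a that has an admirer, top(next(a), {a, partner of next(a)}),
     answered by a.
   The answers of the first kind show that no a has an admirer above next(a), and
   those of the second kind show that next(a) does admire a.  So M is stable for
   every consistent profile.  If N is stable for such a profile and better than M
   for some b, then the set of A-agents who prefer M to N is nonempty and closed
   under a |-> partner of next(a), and this map does not depend on the profile.
   It therefore has a cycle, and giving next(a) to each a on the cycle produces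
   (for the true profile) a stable matching better than M for the B-side.

   All sets and tests involved are given by expressions built from bounded sums,
   whence the polynomial-time program.
*)
Require Import Defs.
From mathcomp Require Import all_boot all_fingroup.

Set Implicit Arguments.
Unset Strict Implicit.
Unset Printing Implicit Defensive.

(** * Rotations and queries *)

Lemma topP n (PB : profile n) q x :
  top PB q = Some x ->
  x \in q.2 /\ forall y, y \in q.2 -> y != x -> PB q.1 x y.
Proof.
rewrite /top; case: pickP => // y /andP[yS /'forall_implyP y_best] [<-].
by split=> // z /y_best /implyP.
Qed.

Lemma topE n (PB : profile n) b (S : {set 'I_n}) x :
  strict_order (PB b) -> x \in S ->
  (forall y, y \in S -> y != x -> PB b x y) -> top PB (b, S) = Some x.
Proof.
move=> [irr tr _] xS x_best; rewrite /top /=; case: pickP => [y | /(_ x)].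
  case/andP=> yS /'forall_implyP y_best; congr Some; apply/eqP.
  apply: contraT => neq_yx; have xy := x_best y yS neq_yx.
  have := y_best x xS; rewrite eq_sym neq_yx => /(tr _ _ _ xy).
  by rewrite irr.
rewrite xS => /negP[]; apply/'forall_implyP => y yS.
by apply/implyP; apply: x_best.
Qed.

Section Queries.

Variables (n : nat) (PA PB : profile n) (M : {perm 'I_n}).

Definition prefers_to_partner (a b : 'I_n) : bool := PB b a (partnerB M b).

(* If [a] lies on a rotation, then [b] is the new partner of [a] after its
   elimination. *)
Definition first_admirer (a b : 'I_n) : bool :=
  prefers_to_partner a b && [forall x, PA a x b ==> ~~ prefers_to_partner a x].

(** For strict orders, [~~ PA a b x] says that [x] is [b] or is ranked above [b] by [a]. *)
Definition not_admired_upto (b : 'I_n) : {set 'I_n} :=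
  [set a | [forall x, ~~ PA a b x ==> ~~ prefers_to_partner a x]].

Definition partner_query (b : 'I_n) : query n := (b, not_admired_upto b).

Definition admirer_query (p : 'I_n * 'I_n) : query n :=
  (p.2, [set p.1; partnerB M p.2]).

(** The list follows two nested loops over [a] and [b], so that it can be matched with the program
    output entry by entry. *)
Definition admirer_pairs : seq ('I_n * 'I_n) :=
  [seq p <- [seq (a, b) | a <- enum 'I_n, b <- enum 'I_n] | first_admirer p.1 p.2].

Definition rotation_queries : seq (query n) :=
  map partner_query (enum 'I_n) ++ map admirer_query admirer_pairs.

Hypotheses (strictA : strict_profile PA) (strictB : strict_profile PB).

Lemma admirer_neq a b : prefers_to_partner a b -> a != partnerB M b.
Proof.
have [irr _ _] := strictB b; rewrite /prefers_to_partner.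
by apply: contraTneq => {1}->; rewrite irr.
Qed.

Lemma first_admirer_uniq a b c :
  first_admirer a b -> first_admirer a c -> b = c.
Proof.
have [_ _ tot] := strictA a.
move=> /andP[wb /forallP lb] /andP[wc /forallP lc].
apply/eqP/contraT => /tot/orP[bc | cb].
  by have := lc b; rewrite bc wb.
by have := lb c; rewrite cb wc.
Qed.

(** Induction on the number of agents that [a] ranks above [b]: an admirer [x] among them can
    replace [b], and the set shrinks because it loses [x]. *)
Lemma exists_first_admirer a b :
  prefers_to_partner a b ->
  exists2 c, first_admirer a c & c = b \/ PA a c b.
Proof.
have [irr tr tot] := strictA a.
have [k] := ubnP #|[set x | PA a x b]|; elim: k b => // k IHk b lt_k wb.
have [/forallP lb | ] := boolP [forall x, PA a x b ==> ~~ prefers_to_partner a x].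
  by exists b; [rewrite /first_admirer wb; apply/forallP | left].
rewrite negb_forall => /existsP[x]; rewrite negb_imply negbK => /andP[xb wx].
have [|c fc cx] := IHk x _ wx; last first.
  by exists c => //; right; case: cx => [-> // | cx]; apply: tr xb.
rewrite -ltnS; apply: leq_trans lt_k; rewrite ltnS; apply: proper_card.
apply/properP; split.
  by apply/subsetP => y; rewrite !inE => /tr; apply.
by exists x; rewrite !inE ?irr.
Qed.

Lemma not_admired_uptoW a b : a \in not_admired_upto b -> ~~ prefers_to_partner a b.
Proof.
by have [irr _ _] := strictA a; rewrite inE => /forallP/(_ b); rewrite irr.
Qed.

Hypothesis Mopt : B_optimal PA PB M.

(** Otherwise [a] and [x] would block [M]; by irreflexivity, [x] is not the partner of [a]. *)
Lemma no_admirer_upto_partner a x :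
  ~~ PA a (partnerA M a) x -> ~~ prefers_to_partner a x.
Proof.
have [irr tr tot] := strictA a.
move=> nbx; apply/negP => wx.
have neq : x != partnerA M a.
  apply: contraTneq wx => ->; rewrite /prefers_to_partner /partnerB permK.
  by have [irrB _ _] := strictB (M a); rewrite irrB.
case: Mopt => -[]; exists a, x; split=> //.
by have := tot _ _ neq; rewrite (negbTE nbx) orbF.
Qed.

Lemma partner_query_top b : top PB (partner_query b) = Some (partnerB M b).
Proof.
have [irr tr tot] := strictB b.
apply: topE => //.
  rewrite inE; apply/forallP => x; apply/implyP.
  by have := @no_admirer_upto_partner (partnerB M b) x; rewrite /partnerA permKV.
move=> a /not_admired_uptoW; rewrite /prefers_to_partner => nw /tot.
by rewrite (negbTE nw).
Qed.

Lemma admirer_query_top a b :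
  prefers_to_partner a b -> top PB (admirer_query (a, b)) = Some a.
Proof.
move=> wab; apply: topE => //; first by rewrite !inE eqxx.
by move=> y; rewrite !inE => /orP[/eqP-> | /eqP->] //; rewrite eqxx.
Qed.

Lemma mem_admirer_pairs p : (p \in admirer_pairs) = first_admirer p.1 p.2.
Proof.
rewrite mem_filter andb_idr // => _.
by case: p => a b; apply/allpairsP; exists (a, b); rewrite !mem_enum.
Qed.

Lemma uniq_admirer_pairs : uniq admirer_pairs.
Proof.
apply: filter_uniq; apply: allpairs_uniq; rewrite ?enum_uniq //.
by move=> [a b] [c d].
Qed.

(** The answers tell the queries apart: a partner query is answered by the partner of its agent, an
    admirer query by some other agent, and from that answer the pair can be recovered. *)
Lemma uniq_rotation_queries : uniq rotation_queries.
Proof.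
rewrite cat_uniq map_inj_uniq ?enum_uniq /=; last by move=> a b [].
rewrite map_inj_in_uniq ?uniq_admirer_pairs ?andbT; last first.
  move=> [a b] [c d]; rewrite !mem_admirer_pairs /= => /andP[wab _] /andP[wcd _] eq_q.
  have := admirer_query_top wab; rewrite eq_q admirer_query_top // => -[ac].
  by case: eq_q => <- _; rewrite ac.
apply/hasPn => _ /mapP[[a b] + ->]; rewrite mem_admirer_pairs => /andP[/= wab _].
apply/mapP => -[c _ eq_q]; have := admirer_query_top wab.
rewrite eq_q partner_query_top; case: eq_q => <- _ [ba].
by have := admirer_neq wab; rewrite ba eqxx.
Qed.

(** Each [a] has at most one first admirer, so the first projection is injective on the pairs, and
    each kind of query occurs at most [n] times. *)
Lemma size_rotation_queries : size rotation_queries <= 2 * n.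
Proof.
rewrite /rotation_queries size_cat (size_map partner_query) (size_map admirer_query).
rewrite size_enum_ord mul2n -addnn leq_add2l.
rewrite -(size_map fst) -[leqRHS](size_enum_ord n); apply: uniq_leq_size; last first.
  by move=> a; rewrite mem_enum.
rewrite map_inj_in_uniq ?uniq_admirer_pairs // => -[a b] [c d].
rewrite !mem_admirer_pairs /= => fab /[swap] ac; rewrite -{c}ac => fad.
by rewrite (first_admirer_uniq fab fad).
Qed.

(* A set closed under [a |-> partner of the first admirer of a] contains a
   cycle of that map; moving the agents of the cycle to their first admirers
   would give a stable matching that is better for the B-side. *)
Lemma no_rotation (A : {set 'I_n}) (nxt : 'I_n -> 'I_n) :
  {in A, forall a, first_admirer a (nxt a) /\ partnerB M (nxt a) \in A} ->
  A = set0.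
Proof.
move=> HA; apply/eqP/contraT => A0.
pose f a := partnerB M (nxt a).
pose closed_in (X : {set 'I_n}) := [&& X != set0, X \subset A & f @: X \subset X].
have PA0 : closed_in A.
  rewrite /closed_in A0 subxx; apply/subsetP => _ /imsetP[a aA ->].
  by have [] := HA a aA.
(* A minimal nonempty closed set serves as the cycle: its image is closed too, hence equal to it, so
   [f] permutes it. *)
have [X /minsetP[/and3P[X0 XA fX] Xmin] _] := minset_exists PA0.
have fXX : f @: X = X.
  apply: Xmin => //; apply/and3P; split; first by rewrite imset_eq0.
    exact: subset_trans XA.
  exact: imsetS.
have f_inj : {in X &, injective f} by apply/imset_injP; rewrite fXX.
have Mf a : M (f a) = nxt a by rewrite /f /partnerB permKV.
pose g a := if a \in X then nxt a else M a.
have g_inj : injective g.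
  move=> a c; rewrite /g; case: ifPn => aX; case: ifPn => cX.
  - by rewrite -!Mf => /perm_inj; apply: f_inj.
  - rewrite -Mf => /perm_inj fac; case/negP: cX; rewrite -fac -fXX.
    exact: imset_f.
  - rewrite -Mf => /perm_inj fca; case/negP: aX; rewrite fca -fXX.
    exact: imset_f.
  - exact: perm_inj.
pose N : {perm 'I_n} := perm g_inj.
have NE a : N a = g a by rewrite permE.
have [Mstab Mbest] := Mopt.
have better a : partnerB M (N a) = a \/ prefers_to_partner a (N a).
  rewrite NE /g; case: ifPn => aX; last by left; rewrite /partnerB permK.
  by right; have [/andP[]] := HA a (subsetP XA a aX).
have Nstab : stable PA PB N.
  (* No B-agent loses in passing from [M] to [N], so a blocking [b] is an admirer of [a]. If [a] is
     in [X], it already has its highest admirer; otherwise it keeps its partner and the pair blocks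
     [M]. *)
  move=> [a [b [neq aPb bPa]]].
  have wab : prefers_to_partner a b.
    have := better (partnerB N b); rewrite /prefers_to_partner.
    rewrite [N _]permKV; case=> [-> // | ].
    by have [_ tr _] := strictB b; apply: tr bPa.
  move: neq aPb; rewrite /partnerA NE /g; case: ifPn => aX neq aPb.
    have [/andP[_ /forallP/(_ b)]] := HA a (subsetP XA a aX).
    by rewrite aPb wab.
  by case: Mstab; exists a, b.
(* Any [a] in [X] gives a contradiction: [nxt a] strictly gains under the stable matching [N]. *)
have [a aX] := set0Pn _ X0.
have [/andP[wab _] _] := HA a (subsetP XA a aX).
have Na : N a = nxt a by rewrite NE /g aX.
have NVa : partnerB N (nxt a) = a by rewrite /partnerB -Na permK.
have [irr tr _] := strictB (nxt a).
have := Mbest N Nstab (nxt a); rewrite /weakly_prefers NVa.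
case=> [eq_a | /tr/(_ wab)]; last by rewrite irr.
by have := admirer_neq wab; rewrite eq_a eqxx.
Qed.

Lemma rotation_queries_verify : verifies_B_optimal PA PB M rotation_queries.
Proof.
move=> PB' strictB' cons.
have topM b a : a \in not_admired_upto b -> a != partnerB M b ->
    PB' b (partnerB M b) a.
  have /topP[_] : top PB' (partner_query b) = Some (partnerB M b).
    rewrite -partner_query_top; apply: cons.
    by rewrite mem_cat map_f // mem_enum.
  exact.
have topF a b : first_admirer a b -> PB' b a (partnerB M b).
  move=> fab; have /andP[wab _] := fab.
  have /topP[_] : top PB' (admirer_query (a, b)) = Some a.
    rewrite -(admirer_query_top wab); apply: cons.
    by rewrite mem_cat (map_f admirer_query) ?orbT // mem_admirer_pairs.
  by apply; rewrite ?inE ?eqxx ?orbT // eq_sym admirer_neq.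
(* If the answers allow [b] to prefer [a] to its partner, then [a] is outside the set queried at
   [b], so a true admirer of [a] is ranked at [b] or above. *)
have admired a b : PB' b a (partnerB M b) ->
    exists2 c, first_admirer a c & c = b \/ PA a c b.
  have [irr tr tot] := strictB' b; have [_ _ totA] := strictA a.
  move=> wab.
  have : a \notin not_admired_upto b.
    apply: contraL wab => aT; have [-> | neq] := eqVneq a (partnerB M b).
      by rewrite irr.
    by apply/negP => /(tr _ _ _ (topM _ _ aT neq)); rewrite irr.
  rewrite inE negb_forall => /existsP[x]; rewrite negb_imply negbK => /andP[nbx wx].
  have [c fc cx] := exists_first_admirer wx; exists c => //.
  have [<- // | neq] := eqVneq x b.
  have xb : PA a x b by have := totA _ _ neq; rewrite (negbTE nbx) orbF.
  have [_ trA _] := strictA a.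
  by right; case: cx => [-> // | cx]; apply: trA xb.
have worse a c : first_admirer a c -> PA a (M a) c.
  have [_ _ totA] := strictA a; move=> /andP[wac _].
  apply: contraLR wac; exact: no_admirer_upto_partner.
(* A blocking pair would give a first admirer at [b] or above, which by [worse] comes after [M a],
   while [a] ranks [b] before [M a]. *)
have Mstab : stable PA PB' M.
  move=> [a [b [neq aPb bPa]]].
  have [irrA trA _] := strictA a.
  have [c /worse Mac [cb | cb]] := admired _ _ bPa.
    by rewrite cb in Mac; have := trA _ _ _ Mac aPb; rewrite irrA.
  by have := trA _ _ _ (trA _ _ _ Mac cb) aPb; rewrite irrA.
split=> //; split=> // N Nstab.
pose better b := PB' b (partnerB N b) (partnerB M b).
pose A : {set 'I_n} := [set a | better (M a)].
pose nxt a := odflt a [pick c | first_admirer a c].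
(* [A] is also the set of the A-agents who prefer [M] to [N]. *)
have A_prefers a : better (N a) -> PA a (M a) (N a).
  rewrite /better {1}/partnerB permK => wa.
  have neq : N a != partnerA M a.
    apply: contraTneq wa => ->; rewrite /partnerA /partnerB permK.
    by have [irr _ _] := strictB' (M a); rewrite irr.
  have [_ _ totA] := strictA a; have := totA _ _ neq; case/orP=> // aN.
  by case: Mstab; exists a, (N a).
have prefers_A a : PA a (M a) (N a) -> a \in A.
  move=> aM; have [irrA _ _] := strictA a.
  have neq : M a != partnerA N a.
    by apply: contraTneq aM => ->; rewrite irrA.
  have neqB : partnerB N (M a) != a.
    by apply: contraNneq neq => {2}<-; rewrite /partnerA /partnerB permKV.
  rewrite inE /better {2}/partnerB permK.
  have [_ _ tot] := strictB' (M a); have := tot _ _ neqB; case/orP=> // bN.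
  by case: Nstab; exists a, (M a).
(* The agents that are [N]-partners of better-off B-agents all lie in [A]. Both sets are preimages
   of the same set under bijections, so they have equal size and coincide. *)
have A_N : {in A, forall a, better (N a)}.
  have sub : [set a | better (N a)] \subset A.
    by apply/subsetP => a; rewrite inE => /A_prefers/prefers_A.
  have card (P : {perm 'I_n}) : #|[set a | better (P a)]| = #|[set b | better b]|.
    rewrite -(card_preimset [set b | better b] (@perm_inj _ P)); apply: eq_card => a.
    by rewrite !inE.
  have /eqP AE : [set a | better (N a)] == A by rewrite eqEcard sub !card leqnn.
  by move=> a; rewrite -AE inE.
have A0 : A = set0.
  (* First admirers are those of the true profile [PB], so its optimality applies although [A] is
     defined through [PB']. *)
  apply: (@no_rotation A nxt) => a aA.
  have bN := A_N a aA; have aMN := A_prefers a bN.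
  have [c fac cN] : exists2 c, first_admirer a c & c = N a \/ PA a c (N a).
    by apply: admired; move: bN; rewrite /better {1}/partnerB permK.
  have -> : nxt a = c.
    rewrite /nxt; case: pickP => [d fad | /(_ c)]; last by rewrite fac.
    exact: first_admirer_uniq fad fac.
  split=> //; rewrite inE /partnerB permKV.
  case: cN => [-> // | aPc].
  have [irrA _ _] := strictA a.
  have neq : c != partnerA N a.
    by apply: contraTneq aPc => ->; rewrite irrA.
  have [irr tr tot] := strictB' c.
  have neqB : partnerB N c != a.
    by apply: contraNneq neq => <-; rewrite /partnerA /partnerB permKV.
  (* Stability of [N] makes [c] prefer its [N]-partner to [a], and the admirer query shows that it
     prefers [a] to its [M]-partner. *)
  have [Nca | caN] := orP (tot _ _ neqB); last by case: Nstab; exists a, c.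
  exact: tr Nca (topF _ _ fac).
move=> b; have : partnerB M b \notin A by rewrite A0 inE.
rewrite inE /better [M _]permKV => nb.
have [-> | neq] := eqVneq (partnerB M b) (partnerB N b); first by left.
have [_ _ tot] := strictB' b; have := tot _ _ neq.
by rewrite (negbTE nb) orbF; right.
Qed.
End Queries.

(** * Polynomial-time programs *)

(** The base [n.+1] is positive, so that raising the degree never lowers the bound, not even at
    [n = 0]. *)
Definition poly_bounded (p : nat -> nat) : Prop :=
  exists K d, forall n, p n <= K * n.+1 ^ d.

Lemma poly_bounded_const c : poly_bounded (fun=> c).
Proof. by exists c, 0 => n; rewrite muln1. Qed.

Lemma poly_bounded_id : poly_bounded id.
Proof. by exists 1, 1 => n; rewrite mul1n expn1. Qed.

Lemma poly_boundedD p q :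
  poly_bounded p -> poly_bounded q -> poly_bounded (fun n => p n + q n).
Proof.
move=> [K [d Hp]] [L [e Hq]]; exists (K + L), (d + e) => n.
rewrite mulnDl expnD; apply: leq_add.
  by apply: leq_trans (Hp n) _; rewrite mulnA leq_pmulr // expn_gt0.
by apply: leq_trans (Hq n) _; rewrite mulnCA leq_pmull // expn_gt0.
Qed.

Lemma poly_boundedM p q :
  poly_bounded p -> poly_bounded q -> poly_bounded (fun n => p n * q n).
Proof.
move=> [K [d Hp]] [L [e Hq]]; exists (K * L), (d + e) => n.
by rewrite expnD mulnACA; apply: leq_mul.
Qed.

(** * Time-bounded total correctness rules *)

Definition halts (c : prog) (s : state) (T : nat) (Q : state -> Prop) : Prop :=
  exists t s', [/\ exec c s t s', t <= T & Q s'].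

Lemma halts_weaken c s T T' (Q Q' : state -> Prop) :
  T <= T' -> (forall u, Q u -> Q' u) -> halts c s T Q -> halts c s T' Q'.
Proof.
move=> TT' QQ' [t [u [cu tT /QQ' Qu]]]; exists t, u.
by split=> //; apply: leq_trans TT'.
Qed.

Lemma halts_skip s (Q : state -> Prop) : Q s -> halts Skip s 1 Q.
Proof. by move=> Qs; exists 1, s; split=> //; apply: ExecSkip. Qed.

Lemma halts_assign r e s (Q : state -> Prop) :
  Q (State (update (regs s) r (eval s e)) (Defs.mem s) (out s)) ->
  halts (Assign r e) s (expr_cost e).+1 Q.
Proof. by move=> Qs; do 2!eexists; split; [apply: ExecAssign | | ]. Qed.

Lemma halts_emit e s (Q : state -> Prop) :
  Q (State (regs s) (Defs.mem s) (rcons (out s) (eval s e))) ->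
  halts (Emit e) s (expr_cost e).+1 Q.
Proof. by move=> Qs; do 2!eexists; split; [apply: ExecEmit | | ]. Qed.

Lemma halts_then c1 c2 s T1 T2 (Q R : state -> Prop) :
  halts c1 s T1 Q -> (forall u, Q u -> halts c2 u T2 R) ->
  halts (Then c1 c2) s (T1 + T2) R.
Proof.
move=> [t1 [u [c1u t1T Qu]]] /(_ u Qu)[t2 [v [c2v t2T Rv]]].
exists (t1 + t2), v; split=> //; first exact: ExecThen c1u c2v.
exact: leq_add.
Qed.

(** Adding the bounds of the branches, rather than taking their maximum, leaves a sum to which
    [poly_boundedD] applies. *)
Lemma halts_if e c1 c2 s T1 T2 (Q : state -> Prop) :
  (eval s e != 0 -> halts c1 s T1 Q) -> (eval s e = 0 -> halts c2 s T2 Q) ->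
  halts (If e c1 c2) s (expr_cost e + T1 + T2).+1 Q.
Proof.
move=> H1 H2; case: (eqVneq (eval s e) 0) => [e0 | e1].
  have [t [u [cu tT Qu]]] := H2 e0.
  exists (expr_cost e + t).+1, u; split=> //; first exact: ExecIfFalse.
  by rewrite ltnS -addnA leq_add2l; apply: leq_trans tT (leq_addl _ _).
have [t [u [cu tT Qu]]] := H1 e1.
exists (expr_cost e + t).+1, u; split=> //; first exact: ExecIfTrue.
by rewrite ltnS -addnA leq_add2l; apply: leq_trans tT (leq_addr _ _).
Qed.

Definition for_loop (i : nat) (c : prog) : prog :=
  Then (Assign i (Const 0))
    (While (Bin Lt (Reg i) (Fetch (Const 0)))
       (Then c (Assign i (Bin Plus (Reg i) (Const 1))))).

(** An iteration costs 4 for the test, 4 for the increment and 1 for the loop step besides [T]. The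
    7 is 2 for the initialization and 5 for the failing test. *)
Lemma halts_for i c s T n (Inv : nat -> state -> Prop) :
  (forall j u, Inv j u -> regs u i = j /\ Defs.mem u 0 = n) ->
  (forall j u, j < n -> Inv j u ->
     halts c u T (fun v => Inv j.+1
       (State (update (regs v) i (regs v i + 1)) (Defs.mem v) (out v)))) ->
  Inv 0 (State (update (regs s) i 0) (Defs.mem s) (out s)) ->
  halts (for_loop i c) s (n * (T + 9) + 7) (Inv n).
Proof.
move=> Hinv Hstep H0.
suff loop j u : Inv j u -> j <= n ->
    halts (While (Bin Lt (Reg i) (Fetch (Const 0)))
       (Then c (Assign i (Bin Plus (Reg i) (Const 1))))) u
      ((n - j) * (T + 9) + 5) (Inv n).
  have := halts_then (halts_assign (e := Const 0) H0) (fun u Hu => loop 0 u Hu isT).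
  by apply: halts_weaken => //; rewrite subn0 /= addnCA.
move def_m: (n - j) => m; elim: m j u def_m => [|m IHm] j u def_m Iju le_jn.
  have /eqP nj: n == j by rewrite eqn_leq le_jn andbT -subn_eq0 def_m.
  rewrite -nj in Iju; have [ui un] := Hinv _ _ Iju.
  exists 5, u; split=> //.
  by apply: (@ExecWhileFalse (Bin Lt (Reg i) (Fetch (Const 0)))); rewrite /= ui un ltnn.
have lt_jn : j < n by rewrite -subn_gt0 def_m.
have [ui un] := Hinv _ _ Iju.
have [t1 [v [cv t1T Iv]]] := halts_then (Hstep j u lt_jn Iju)
  (fun v Iv => halts_assign (e := Bin Plus (Reg i) (Const 1)) Iv).
have [|t2 [w [lw t2T Iw]]] := IHm _ _ _ Iv lt_jn.
  by rewrite subnS def_m.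
exists (4 + t1 + t2).+1, w; split=> //.
  by apply: (ExecWhileTrue _ cv lw); rewrite /= ui un lt_jn.
rewrite /= in t1T; rewrite mulSn -!addnS -addnA.
apply: leq_trans (_ : (4 + ((T + 4) + (m * (T + 9) + 5).+1)) <= _).
  by rewrite leq_add2l leq_add.
by rewrite -addnA !addnS !addSn !addnA ?addn0 ?add0n.
Qed.

(** [F m vs] is computed from the memory [m] and the values [vs] of some
    registers.  Only register [k] and those above it may be overwritten, and the
    memory is never changed. *)
Definition computable (F : (nat -> nat) -> seq nat -> nat) : Prop :=
  exists (c : seq nat -> nat -> prog) (p : nat -> nat),
  poly_bounded p /\
  forall rs k s, all (gtn k) rs ->
  halts (c rs k) s (p (Defs.mem s 0)) (fun u =>
    [/\ regs u k = F (Defs.mem s) (map (regs s) rs),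
        forall j, j < k -> regs u j = regs s j,
        Defs.mem u = Defs.mem s & out u = out s]).

Definition emittable (G : (nat -> nat) -> seq nat -> seq nat) : Prop :=
  exists (c : seq nat -> nat -> prog) (p : nat -> nat),
  poly_bounded p /\
  forall rs k s, all (gtn k) rs ->
  halts (c rs k) s (p (Defs.mem s 0)) (fun u =>
    [/\ forall j, j < k -> regs u j = regs s j,
        Defs.mem u = Defs.mem s &
        out u = out s ++ G (Defs.mem s) (map (regs s) rs)]).

Lemma map_agree k (f g : nat -> nat) rs :
  all (gtn k) rs -> (forall j, j < k -> f j = g j) -> map f rs = map g rs.
Proof. by move=> /allP rs_k fg; apply/eq_in_map => j /rs_k /fg. Qed.

Lemma all_gtnS k rs : all (gtn k) rs -> all (gtn k.+1) rs.
Proof. by apply: sub_all => j /= /ltnW. Qed.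

Lemma update_same f i v : update f i v i = v.
Proof. by rewrite /update eqxx. Qed.

Lemma update_lt f i v j : j < i -> update f i v j = f j.
Proof. by rewrite /update => /ltn_eqF ->. Qed.

(** * Closure properties of computable functions *)

Lemma computable_ext F F' :
  (forall m v, F m v = F' m v) -> computable F -> computable F'.
Proof.
move=> FF' [c [p [Hp Hc]]]; exists c, p; split=> // rs k s rs_k.
by apply: halts_weaken (Hc rs k s rs_k) => // u; rewrite FF'.
Qed.

Lemma computable_expr (e : seq nat -> expr) K F :
  (forall rs, expr_cost (e rs) <= K) ->
  (forall rs s, eval s (e rs) = F (Defs.mem s) (map (regs s) rs)) ->
  computable F.
Proof.
move=> eK eF; exists (fun rs k => Assign k (e rs)), (fun=> K.+1).
split=> [|rs k s rs_k]; first exact: poly_bounded_const.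
apply: (halts_weaken (T := (expr_cost (e rs)).+1) (Q := eq _)) (halts_assign _) => //=.
  by rewrite ltnS.
move=> u <-; split=> //= [|j jk]; first by rewrite update_same.
by rewrite update_lt.
Qed.

Lemma computable_const x : computable (fun _ _ => x).
Proof. exact: (@computable_expr (fun=> Const x) 1). Qed.

Lemma computable_var i : computable (fun _ v => nth 0 v i).
Proof.
(* Out of range, the default [Const 0] agrees with the default of [nth 0]. *)
apply: (@computable_expr (fun rs => nth (Const 0) (map Reg rs) i) 1).
  by move=> rs; elim: rs i => [|r rs IH] [|i] /=.
by move=> rs s; elim: rs i => [|r rs IH] [|i] /=.
Qed.

Lemma computable_fetch F : computable F -> computable (fun m v => m (F m v)).
Proof.
move=> [c [p [Hp Hc]]].
exists (fun rs k => Then (c rs k) (Assign k (Fetch (Reg k)))), (fun n => p n + 3).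
split=> [|rs k s rs_k]; first exact: poly_boundedD (poly_bounded_const 3).
apply: halts_then (Hc rs k s rs_k) _ => u [uk uj um uo].
apply: halts_assign; split=> //= [|j jk]; first by rewrite update_same um uk.
by rewrite update_lt ?uj.
Qed.

Lemma computable_bin o F G :
  computable F -> computable G ->
  computable (fun m v => eval_binop o (F m v) (G m v)).
Proof.
move=> [c [p [Hp Hc]]] [d [q [Hq Hd]]].
(* The second program starts at register [k.+1], so the first result survives in [k]. *)
exists (fun rs k => Then (c rs k) (Then (d rs k.+1)
  (Assign k (Bin o (Reg k) (Reg k.+1))))), (fun n => p n + (q n + 4)).
split=> [|rs k s rs_k].
  by do 2!apply: poly_boundedD => //; apply: poly_bounded_const.
apply: halts_then (Hc rs k s rs_k) _ => u [uk uj um uo].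
rewrite -um; apply: halts_then (Hd rs k.+1 u (all_gtnS rs_k)) _.
move=> w [wk wj wm wo]; apply: halts_assign; split=> /=.
- by rewrite update_same wk wj // uk um (map_agree rs_k uj).
- by move=> j jk; rewrite update_lt // wj ?uj // ltnS ltnW.
- by rewrite wm um.
- by rewrite wo uo.
Qed.

Lemma computable_add F G :
  computable F -> computable G -> computable (fun m v => F m v + G m v).
Proof. exact: (computable_bin Plus). Qed.

Lemma computable_eq F G :
  computable F -> computable G -> computable (fun m v => F m v == G m v).
Proof. exact: (computable_bin Eq). Qed.

Lemma computable_lt F G :
  computable F -> computable G -> computable (fun m v => F m v < G m v).
Proof. exact: (computable_bin Lt). Qed.

Lemma computable_if (b : (nat -> nat) -> seq nat -> bool) G H :
  computable (fun m v => b m v) -> computable G -> computable H ->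
  computable (fun m v => if b m v then G m v else H m v).
Proof.
move=> [c [p [Hp Hc]]] [d [q [Hq Hd]]] [e [r [Hr He]]].
exists (fun rs k => Then (c rs k) (If (Reg k) (d rs k) (e rs k))),
  (fun n => p n + (2 + q n + r n)).
split=> [|rs k s rs_k].
  apply: poly_boundedD => //; apply: poly_boundedD => //.
  by apply: poly_boundedD => //; apply: poly_bounded_const.
apply: halts_then (Hc rs k s rs_k) _ => u [uk uj um uo].
apply: halts_if; rewrite /= uk; case: (b _ _) => // _.
  apply: halts_weaken (Hd rs k u rs_k) => [|w [wk wj wm wo]]; first by rewrite um.
  split; rewrite ?wk ?wm ?wo ?um ?(map_agree rs_k uj) // => j jk.
  by rewrite wj ?uj.
apply: halts_weaken (He rs k u rs_k) => [|w [wk wj wm wo]]; first by rewrite um.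
split; rewrite ?wk ?wm ?wo ?um ?(map_agree rs_k uj) // => j jk.
by rewrite wj ?uj.
Qed.

Lemma computable_sum F :
  computable F ->
  computable (fun m v => \sum_(0 <= i < m 0) F m (i :: v)).
Proof.
move=> [c [p [Hp Hc]]].
(* Register [k] accumulates, [k.+1] counts and [k.+2] receives the summand. The counter is put in
   front of the arguments, so variables behave like de Bruijn indices. *)
pose body rs k := Then (c (k.+1 :: rs) k.+2)
  (Assign k (Bin Plus (Reg k) (Reg k.+2))).
exists (fun rs k => Then (Assign k (Const 0)) (for_loop k.+1 (body rs k))),
  (fun n => 2 + (n * (p n + 4 + 9) + 7)).
split=> [|rs k s rs_k].
  apply: poly_boundedD; first exact: poly_bounded_const.
  apply: poly_boundedD; last exact: poly_bounded_const.
  apply: poly_boundedM; first exact: poly_bounded_id.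
  by do 2![apply: poly_boundedD; last exact: poly_bounded_const].
set m := Defs.mem s; set v := map (regs s) rs.
apply: halts_then (halts_assign (Q := eq _) erefl) _ => _ <- /=.
pose Inv n u := [/\ regs u k = \sum_(0 <= i < n) F m (i :: v),
  regs u k.+1 = n, forall j, j < k -> regs u j = regs s j,
  Defs.mem u = m & out u = out s].
apply: (halts_weaken (Q := Inv (m 0))) (halts_for _ _ _) => //.
- by move=> u [].
- by move=> j u [_ -> _ -> _].
- move=> j u jm [uk uk1 uj um uo].
  have rsk2 : all (gtn k.+2) (k.+1 :: rs) by rewrite /= ltnSn /= 2?all_gtnS.
  rewrite -um; apply: halts_then (Hc _ _ _ rsk2) _ => w [wk wj wm wo].
  apply: halts_assign; rewrite /Inv /= update_same wm um wo uo.
  rewrite [update _ k.+1 _ k]update_lt // update_same.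
  rewrite /update (gtn_eqF (ltnSn k)).
  rewrite (wj k (leqnSn _)) (wj k.+1 (ltnSn _)) uk uk1 wk /= uk1 um.
  rewrite (map_agree rs_k uj) addn1.
  split=> // [|i ik]; first by rewrite big_nat_recr.
  by rewrite !ltn_eqF ?wj ?uj // ltnS ltnW // ltnW.
- split=> //=; first by rewrite update_lt // update_same big_geq.
    by rewrite update_same.
  by move=> j jk; rewrite !update_lt // ltnS ltnW.
Qed.

(** This is a subroutine call: the program for [f] gets a fresh argument list, whatever variables
    surround the call. *)
Lemma computable_comp2 f A B :
  computable (fun m v => f m (nth 0 v 0) (nth 0 v 1)) ->
  computable A -> computable B ->
  computable (fun m v => f m (A m v) (B m v)).
Proof.
move=> [c [p [Hp Hc]]] [a [q [Hq Ha]]] [b [r [Hr Hb]]].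
exists (fun rs k => Then (a rs k) (Then (b rs k.+1)
    (Then (c [:: k; k.+1] k.+2) (Assign k (Reg k.+2))))),
  (fun n => q n + (r n + (p n + 2))).
split=> [|rs k s rs_k].
  by do 3!apply: poly_boundedD => //; apply: poly_bounded_const.
apply: halts_then (Ha rs k s rs_k) _ => u [uk uj um uo].
rewrite -um; apply: halts_then (Hb rs k.+1 u (all_gtnS rs_k)) _.
move=> w [wk wj wm wo].
have kk : all (gtn k.+2) [:: k; k.+1] by rewrite /= ltnS leqnSn ltnSn.
rewrite -wm; apply: halts_then (Hc _ _ w kk) _ => x [xk xj xm xo].
apply: halts_assign; split=> /=; last by rewrite xo wo uo.
- by rewrite update_same xk /= wj // wk uk wm um (map_agree rs_k uj).
- move=> j jk; have jk1 := leqW jk.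
  by rewrite update_lt // xj ?wj ?uj // leqW.
- by rewrite xm wm um.
Qed.

(** * Programs that write lists *)

Lemma emittable_num F : computable F -> emittable (fun m v => [:: F m v]).
Proof.
move=> [c [p [Hp Hc]]].
exists (fun rs k => Then (c rs k) (Emit (Reg k))), (fun n => p n + 2).
split=> [|rs k s rs_k]; first exact: poly_boundedD (poly_bounded_const 2).
apply: halts_then (Hc rs k s rs_k) _ => u [uk uj um uo].
by apply: halts_emit; split=> //=; rewrite cats1 uk uo.
Qed.

Lemma emittable_cat G H :
  emittable G -> emittable H -> emittable (fun m v => G m v ++ H m v).
Proof.
move=> [c [p [Hp Hc]]] [d [q [Hq Hd]]].
exists (fun rs k => Then (c rs k) (d rs k)), (fun n => p n + q n).
split=> [|rs k s rs_k]; first exact: poly_boundedD.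
apply: halts_then (Hc rs k s rs_k) _ => u [uj um uo].
rewrite -um; apply: halts_weaken (Hd rs k u rs_k) => // w [wj wm wo].
split=> [j jk||]; rewrite ?wj ?uj ?wm //.
by rewrite wo uo um (map_agree rs_k uj) catA.
Qed.

Lemma emittable_when (b : (nat -> nat) -> seq nat -> bool) G :
  computable (fun m v => b m v) -> emittable G ->
  emittable (fun m v => if b m v then G m v else [::]).
Proof.
move=> [c [p [Hp Hc]]] [d [q [Hq Hd]]].
exists (fun rs k => Then (c rs k) (If (Reg k) (d rs k) Skip)),
  (fun n => p n + (2 + q n + 1)).
split=> [|rs k s rs_k].
  apply: poly_boundedD => //; apply: poly_boundedD; last exact: poly_bounded_const.
  by apply: poly_boundedD => //; apply: poly_bounded_const.
apply: halts_then (Hc rs k s rs_k) _ => u [uk uj um uo].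
apply: halts_if; rewrite /= uk; case: (b _ _) => // _.
  apply: halts_weaken (Hd rs k u rs_k) => [|w [wj wm wo]]; first by rewrite um.
  split=> [j jk||]; rewrite ?wj ?uj ?wm ?um //.
  by rewrite wo uo um (map_agree rs_k uj).
by apply: halts_skip; split; rewrite ?cats0.
Qed.

Lemma emittable_for G :
  emittable G ->
  emittable (fun m v => \big[cat/[::]]_(0 <= i < m 0) G m (i :: v)).
Proof.
move=> [c [p [Hp Hc]]].
exists (fun rs k => for_loop k (c (k :: rs) k.+1)), (fun n => n * (p n + 9) + 7).
split=> [|rs k s rs_k].
  apply: poly_boundedD; last exact: poly_bounded_const.
  apply: poly_boundedM; first exact: poly_bounded_id.
  by apply: poly_boundedD; last exact: poly_bounded_const.
set m := Defs.mem s; set v := map (regs s) rs.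
pose Inv n u := [/\ regs u k = n, forall j, j < k -> regs u j = regs s j,
  Defs.mem u = m & out u = out s ++ \big[cat/[::]]_(0 <= i < n) G m (i :: v)].
apply: (halts_weaken (Q := Inv (m 0))) (halts_for _ _ _) => //.
- by move=> u [].
- by move=> j u [-> _ -> _].
- move=> j u jm [uk uj um uo].
  have rsk1 : all (gtn k.+1) (k :: rs) by rewrite /= ltnSn /= all_gtnS.
  rewrite -um; apply: halts_weaken (Hc _ _ u rsk1) => // w [wj wm wo].
  rewrite /Inv /= update_same wm um wo uo wj // uk addn1.
  split=> // [i ik|]; first by rewrite update_lt // wj ?uj // ltnS ltnW.
  by rewrite big_nat_recr //= um uk (map_agree rs_k uj) catA.
- split=> //=; first by rewrite update_same.
    by move=> j jk; rewrite update_lt.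
  by rewrite big_geq // cats0.
Qed.

(** * The program that outputs the queries *)

(* The input after its first entry is a table with rows of length [m 0]: the
   lists of the A-agents, those of the B-agents, and the values of the matching.
   Multiplication is not a machine operation, hence the sum. *)
Definition cell (m : nat -> nat) (y k : nat) : nat :=
  m (1 + (\sum_(0 <= i < m 0) y + k)).

(** In a row without repetitions a single summand survives, so the sum is a search for the position
    of [x]. *)
Definition rank (m : nat -> nat) (y x : nat) : nat :=
  \sum_(0 <= k < m 0) if cell m y k == x then k else 0.

(** Row [n + n] lists the values of the matching, so searching it inverts the matching. *)
Definition partner (m : nat -> nat) (b : nat) : nat := rank m (m 0 + m 0) b.

Definition admires (m : nat -> nat) (b a : nat) : bool :=
  rank m (m 0 + b) a < rank m (m 0 + b) (partner m b).

(** The universal quantifier becomes the vanishing of a sum that counts counterexamples. *)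
Definition in_partner_query (m : nat -> nat) (b a : nat) : bool :=
  \sum_(0 <= x < m 0) (if rank m a b < rank m a x then 0 else admires m x a) == 0.

Definition is_first_admirer (m : nat -> nat) (a b : nat) : bool :=
  if admires m b a then
    \sum_(0 <= x < m 0) (if rank m a x < rank m a b then admires m x a : nat else 0)
      == 0
  else false.

Definition in_admirer_query (m : nat -> nat) (a b x : nat) : bool :=
  if x == a then true else x == partner m b.

Definition query_output (m : nat -> nat) : seq nat :=
  \big[cat/[::]]_(0 <= b < m 0)
     ([:: b] ++ \big[cat/[::]]_(0 <= a < m 0) [:: in_partner_query m b a : nat]) ++
  \big[cat/[::]]_(0 <= a < m 0) \big[cat/[::]]_(0 <= b < m 0)
     if is_first_admirer m a b then
       [:: b] ++ \big[cat/[::]]_(0 <= x < m 0) [:: in_admirer_query m a b x : nat]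
     else [::].

(** * Computability of the output *)

Lemma computable_cell : computable (fun m v => cell m (nth 0 v 0) (nth 0 v 1)).
Proof.
apply: computable_fetch; apply: computable_add.
  exact: computable_const.
apply: computable_add; last exact: computable_var.
exact: (computable_sum (computable_var 1)).
Qed.

Lemma computable_rank : computable (fun m v => rank m (nth 0 v 0) (nth 0 v 1)).
Proof.
apply: (@computable_sum (fun m v => if cell m (nth 0 v 1) (nth 0 v 0) == nth 0 v 2
  then nth 0 v 0 else 0)).
apply: computable_if; last exact: computable_const; last exact: computable_var.
apply: computable_eq; last exact: computable_var.
exact: computable_comp2 computable_cell (computable_var 1) (computable_var 0).
Qed.

Lemma computable_size : computable (fun m _ => m 0).
Proof. exact: computable_fetch (computable_const 0). Qed.

Lemma computable_partner : computable (fun m v => partner m (nth 0 v 0)).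
Proof.
apply: (computable_comp2 computable_rank); last exact: computable_var.
exact: computable_add computable_size computable_size.
Qed.

Lemma computable_admires :
  computable (fun m v => admires m (nth 0 v 0) (nth 0 v 1)).
Proof.
have row : computable (fun m v => m 0 + nth 0 v 0).
  exact: computable_add computable_size (computable_var 0).
apply: computable_lt.
  exact: computable_comp2 computable_rank row (computable_var 1).
exact: computable_comp2 computable_rank row computable_partner.
Qed.

Lemma computable_in_partner_query :
  computable (fun m v => in_partner_query m (nth 0 v 0) (nth 0 v 1)).
Proof.
apply: computable_eq; last exact: computable_const.
apply: (@computable_sum (fun m v =>
  if rank m (nth 0 v 2) (nth 0 v 1) < rank m (nth 0 v 2) (nth 0 v 0) then 0
  else admires m (nth 0 v 0) (nth 0 v 2))).
apply: computable_if; first apply: computable_lt.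
- exact: computable_comp2 computable_rank (computable_var 2) (computable_var 1).
- exact: computable_comp2 computable_rank (computable_var 2) (computable_var 0).
- exact: computable_const.
- exact: (computable_comp2 (f := fun m b a => admires m b a)) computable_admires
    (computable_var 0) (computable_var 2).
Qed.

Lemma computable_is_first_admirer :
  computable (fun m v => is_first_admirer m (nth 0 v 0) (nth 0 v 1)).
Proof.
have adm i j : computable (fun m v => admires m (nth 0 v i) (nth 0 v j)).
  exact: (computable_comp2 (f := fun m b a => admires m b a)) computable_admires
    (computable_var i) (computable_var j).
pose least m v :=
  \sum_(0 <= x < m 0) (if rank m (nth 0 v 0) x < rank m (nth 0 v 0) (nth 0 v 1)
                       then admires m x (nth 0 v 0) : nat else 0) == 0.
(* [computable_if] needs numerical branches, so the coercion from [bool] is moved inside the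
   conditional. *)
apply: (computable_ext (F := fun m v =>
  if admires m (nth 0 v 1) (nth 0 v 0) then least m v : nat else 0)).
  by move=> m v; rewrite /is_first_admirer; case: ifP.
apply: computable_if; [exact: adm | | exact: computable_const].
apply: computable_eq; last exact: computable_const.
apply: (@computable_sum (fun m v =>
  if rank m (nth 0 v 1) (nth 0 v 0) < rank m (nth 0 v 1) (nth 0 v 2)
  then admires m (nth 0 v 0) (nth 0 v 1) : nat else 0)).
apply: computable_if; [apply: computable_lt | exact: adm |].
- exact: computable_comp2 computable_rank (computable_var 1) (computable_var 0).
- exact: computable_comp2 computable_rank (computable_var 1) (computable_var 2).
- exact: computable_const.
Qed.

Lemma emittable_query_output : emittable (fun m _ => query_output m).
Proof.
apply: emittable_cat.
  apply: (@emittable_for (fun m v => [:: nth 0 v 0] ++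
    \big[cat/[::]]_(0 <= a < m 0) [:: in_partner_query m (nth 0 v 0) a : nat])).
  apply: emittable_cat; first exact: emittable_num (computable_var 0).
  apply: (@emittable_for (fun m v =>
    [:: in_partner_query m (nth 0 v 1) (nth 0 v 0) : nat])).
  apply: emittable_num.
  exact: (computable_comp2 (f := fun m b a => in_partner_query m b a))
    computable_in_partner_query (computable_var 1) (computable_var 0).
apply: (@emittable_for (fun m v => \big[cat/[::]]_(0 <= b < m 0)
  if is_first_admirer m (nth 0 v 0) b then [:: b] ++
    \big[cat/[::]]_(0 <= x < m 0) [:: in_admirer_query m (nth 0 v 0) b x : nat]
  else [::])).
apply: (@emittable_for (fun m v =>
  if is_first_admirer m (nth 0 v 1) (nth 0 v 0) then [:: nth 0 v 0] ++
    \big[cat/[::]]_(0 <= x < m 0)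
      [:: in_admirer_query m (nth 0 v 1) (nth 0 v 0) x : nat]
  else [::])).
apply: emittable_when.
  exact: (computable_comp2 (f := fun m a b => is_first_admirer m a b))
    computable_is_first_admirer (computable_var 1) (computable_var 0).
apply: emittable_cat; first exact: emittable_num (computable_var 0).
apply: (@emittable_for (fun m v =>
  [:: in_admirer_query m (nth 0 v 2) (nth 0 v 1) (nth 0 v 0) : nat])).
apply: emittable_num.
apply: (computable_ext (F := fun m v => if nth 0 v 0 == nth 0 v 2 then 1
  else nth 0 v 0 == partner m (nth 0 v 1))).
  by move=> m v; rewrite /in_admirer_query; case: ifP.
apply: computable_if; last 1 first.
- apply: computable_eq; first exact: computable_var.
  exact: (computable_comp2 (f := fun m b _ => partner m b)) computable_partner
    (computable_var 1) (computable_const 0).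
- exact: computable_eq (computable_var 0) (computable_var 2).
- exact: computable_const.
Qed.

(** * Decoding the input *)

Lemma nth_flatten_const (T : Type) (x0 : T) n (ss : seq (seq T)) i k :
  all (fun s => size s == n) ss -> i < size ss -> k < n ->
  nth x0 (flatten ss) (i * n + k) = nth x0 (nth [::] ss i) k.
Proof.
elim: ss i => // s ss IH [|i] /= /andP[/eqP sn ssn] i_ss k_n; rewrite nth_cat sn.
  by rewrite k_n.
by rewrite mulSn -addnA ltnNge leq_addr /= addKn IH.
Qed.

Lemma sum_index (s : seq nat) x :
  uniq s -> x \in s ->
  \sum_(0 <= k < size s) (if nth 0 s k == x then k else 0) = index x s.
Proof.
move=> s_uniq xs; have [i i_s <-] : exists2 i, i < size s & nth 0 s i = x.
  by exists (index x s); rewrite ?index_mem ?nth_index.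
rewrite index_uniq //.
transitivity (\sum_(0 <= k < size s) if k == i then k else 0).
  by apply: eq_big_nat => k /andP[_ k_s]; rewrite nth_uniq.
by rewrite -big_mkcond big_nat1_eq i_s.
Qed.

(** Sortedness shows that earlier entries are preferred. Conversely, equal positions would mean
    equal agents, and reversed positions would contradict the strict order. *)
Lemma index_sort_lt n (r : rel 'I_n) x z :
  strict_order r ->
  (index (val x) (pref_list r) < index (val z) (pref_list r)) = r x z.
Proof.
move=> [irr tr tot]; rewrite /pref_list !(index_map val_inj).
set s := sort _ _; pose r' u w := (u == w) || r u w.
have r'_tr : transitive r'.
  move=> y u w /orP[/eqP-> // | uy] /orP[/eqP<- | yw]; rewrite /r' ?uy ?orbT //.
  by rewrite (tr _ _ _ uy yw) orbT.
have r'_total : total r'.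
  move=> u w; rewrite /r'; have [->|/tot/orP[]->] := eqVneq u w => //.
  by rewrite !orbT.
have lt_r u w : index u s < index w s -> r u w.
  move=> lt_uw.
  have := sorted_ltn_index r'_tr (sort_sorted r'_total (enum 'I_n)) u w.
  rewrite !mem_sort !mem_enum => /(_ isT isT lt_uw)/orP[/eqP eq_uw | //].
  by rewrite eq_uw ltnn in lt_uw.
apply/idP/idP => [/lt_r // | xz]; rewrite ltnNge leq_eqVlt; apply/norP; split.
  apply: contraTN xz => /eqP/(congr1 (nth x s)).
  by rewrite !nth_index ?mem_sort ?mem_enum // => ->; rewrite irr.
by apply/negP => /lt_r /(tr _ _ _ xz); rewrite irr.
Qed.

Lemma size_pref_list n (r : rel 'I_n) : size (pref_list r) = n.
Proof. by rewrite size_map size_sort size_enum_ord. Qed.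

Lemma uniq_pref_list n (r : rel 'I_n) : uniq (pref_list r).
Proof. by rewrite (map_inj_uniq val_inj) sort_uniq enum_uniq. Qed.

Lemma mem_pref_list n (r : rel 'I_n) (x : 'I_n) : val x \in pref_list r.
Proof. by rewrite (mem_map val_inj) mem_sort mem_enum. Qed.

Lemma big_cat_ord n (T : Type) (F : nat -> seq T) :
  \big[cat/[::]]_(0 <= i < n) F i = \big[cat/[::]]_(i <- enum 'I_n) F i.
Proof. by rewrite /index_iota subn0 -val_enum_ord big_map. Qed.

Lemma flatten_big (T : Type) (ss : seq (seq T)) :
  flatten ss = \big[cat/[::]]_(s <- ss) s.
Proof. by elim: ss => [|s ss IH]; rewrite ?big_nil // big_cons -IH. Qed.

Lemma map_big (T U : Type) (f : T -> U) s :
  map f s = \big[cat/[::]]_(x <- s) [:: f x].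
Proof. by elim: s => [|x s IH]; rewrite ?big_nil // big_cons -IH. Qed.

Lemma sum_ord_eq0 n (F : nat -> nat) :
  (\sum_(0 <= x < n) F x == 0) = [forall x : 'I_n, F x == 0].
Proof. by rewrite big_mkord sum_nat_eq0. Qed.

Section Decoding.

Variables (n : nat) (PA PB : profile n) (M : {perm 'I_n}).
Hypotheses (strictA : strict_profile PA) (strictB : strict_profile PB).

Let m := nth 0 (encode_instance PA PB M).

Let rows : seq (seq nat) :=
  [seq pref_list (PA a) | a <- enum 'I_n] ++ [seq pref_list (PB b) | b <- enum 'I_n]
    ++ [:: [seq val (partnerA M a) | a <- enum 'I_n]].

Let rows_size : all (fun s => size s == n) rows.
Proof.
rewrite !all_cat !all_map /= size_map size_enum_ord eqxx !andbT.
by apply/andP; split; apply/allP => y _ /=; rewrite size_pref_list.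
Qed.

Let nth_rowsA (a : 'I_n) : nth [::] rows a = pref_list (PA a).
Proof.
rewrite nth_cat size_map size_enum_ord ltn_ord.
by rewrite (nth_map a) ?size_enum_ord ?nth_ord_enum.
Qed.

Let nth_rowsB (b : 'I_n) : nth [::] rows (n + b) = pref_list (PB b).
Proof.
rewrite nth_cat size_map size_enum_ord ltnNge leq_addr /= addKn nth_cat.
by rewrite size_map size_enum_ord ltn_ord (nth_map b) ?size_enum_ord ?nth_ord_enum.
Qed.

Let nth_rowsM : nth [::] rows (n + n) = [seq val (partnerA M a) | a <- enum 'I_n].
Proof.
rewrite nth_cat size_map size_enum_ord ltnNge leq_addr /= addKn nth_cat.
by rewrite size_map size_enum_ord ltnn subnn.
Qed.

Let rank_row y x : y <= n + n -> uniq (nth [::] rows y) -> x \in nth [::] rows y ->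
  rank m y x = index x (nth [::] rows y).
Proof.
move=> y_le row_uniq x_row.
have y_lt : y < size rows by rewrite !size_cat 2!size_map size_enum_ord addnA addn1 ltnS.
have sz : size (nth [::] rows y) = n by apply/eqP/(all_nthP [::] rows_size).
rewrite -sum_index // sz; apply: eq_big_nat => k /andP[_ k_n].
congr (if _ == _ then _ else _).
(* The sum of [n] copies of [y] is the offset of row [y]; the leading 1 in [cell] skips the entry
   [n]. *)
rewrite /cell sum_nat_const_nat subn0 mulnC -(nth_flatten_const 0 rows_size) //.
by rewrite /m /encode_instance /rows !flatten_cat /= cats0.
Qed.

Let rank_A (a b : 'I_n) : rank m a b = index (val b) (pref_list (PA a)).
Proof.
rewrite rank_row ?nth_rowsA ?uniq_pref_list ?mem_pref_list //.
by rewrite ltnW // ltn_addr.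
Qed.

Let rank_B (b a : 'I_n) : rank m (n + b) a = index (val a) (pref_list (PB b)).
Proof.
rewrite rank_row ?nth_rowsB ?uniq_pref_list ?mem_pref_list //.
by rewrite leq_add2l ltnW.
Qed.

Lemma partner_encoded (b : 'I_n) : partner m b = partnerB M b.
Proof.
have inj : injective (fun a => val (partnerA M a)) by move=> x y /val_inj/perm_inj.
rewrite /partner rank_row ?nth_rowsM ?(map_inj_uniq inj) ?enum_uniq //.
  by rewrite -{1}(permKV M b) (index_map inj) index_enum_ord.
by apply/mapP; exists (partnerB M b); rewrite ?mem_enum // /partnerA permKV.
Qed.

Lemma admires_encoded (b a : 'I_n) : admires m b a = prefers_to_partner PB M a b.
Proof. by rewrite /admires partner_encoded !rank_B index_sort_lt. Qed.

Lemma in_partner_query_encoded (b a : 'I_n) :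
  in_partner_query m b a = (a \in not_admired_upto PA PB M b).
Proof.
rewrite /in_partner_query sum_ord_eq0 inE; apply: eq_forallb => x.
rewrite !rank_A index_sort_lt // admires_encoded.
by case: (PA a b x); case: prefers_to_partner.
Qed.

Lemma is_first_admirer_encoded (a b : 'I_n) :
  is_first_admirer m a b = first_admirer PA PB M a b.
Proof.
rewrite /is_first_admirer /first_admirer admires_encoded sum_ord_eq0.
case: prefers_to_partner => //=; apply: eq_forallb => x.
rewrite !rank_A index_sort_lt // admires_encoded.
by case: (PA a x b); case: prefers_to_partner.
Qed.

Lemma query_output_encoded :
  query_output m = encode_queries (rotation_queries PA PB M).
Proof.
have m0 : m 0 = n by [].
rewrite /encode_queries flatten_big big_map big_cat.
rewrite (big_map (partner_query PA PB M)) (big_map (admirer_query M)).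
congr (_ ++ _).
  rewrite m0 big_cat_ord; apply: eq_bigr => b _; congr (_ :: _).
  rewrite map_big big_cat_ord; apply: eq_bigr => a _.
  by rewrite in_partner_query_encoded.
(* The filter becomes a test inside the double loop, as in the program. *)
rewrite big_filter big_mkcond big_allpairs_dep /= m0 big_cat_ord.
apply: eq_bigr => a _; rewrite big_cat_ord; apply: eq_bigr => b _.
rewrite is_first_admirer_encoded; case: first_admirer => //; congr (_ :: _).
rewrite map_big big_cat_ord; apply: eq_bigr => x _.
rewrite /in_admirer_query partner_encoded !inE.
by rewrite -[val x == _]/(x == _) -[_ == val (partnerB _ _)]/(x == _); case: (x == a).
Qed.

End Decoding.

(** Turns a bound in powers of [n.+1] into one in the length of the input. *)
Lemma size_encode_instance n (PA PB : profile n) (M : {perm 'I_n}) :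
  n < size (encode_instance PA PB M).
Proof. by rewrite /= ltnS !size_cat size_map size_enum_ord addnA leq_addl. Qed.

Theorem theorem23 :
  exists (alg : prog) (C K d : nat),
  forall (n : nat) (PA PB : profile n) (M : {perm 'I_n}),
    strict_profile PA -> strict_profile PB -> B_optimal PA PB M ->
    exists (qs : seq (query n)) (t : nat),
      [/\ computes alg (encode_instance PA PB M) (encode_queries qs) t,
          t <= K * size (encode_instance PA PB M) ^ d,
          uniq qs,
          size qs <= C * n &
          verifies_B_optimal PA PB M qs].
Proof.
have [c [p [[K [d p_le]] run]]] := emittable_query_output.
exists (c [::] 0), 2, K, d => n PA PB M strictA strictB Mopt.
have [t [s [exec_s t_le [_ _ out_s]]]] :=
  run [::] 0 (init_state (encode_instance PA PB M)) isT.
exists (rotation_queries PA PB M), t; split.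
- by exists s; rewrite // out_s /= query_output_encoded.
- apply: leq_trans t_le _; apply: leq_trans (p_le _) _.
  (* The exponent 0 is split off because [leq_exp2r] needs a positive one. *)
  rewrite leq_mul2l; apply/orP; right; case: (d) => // e.
  by rewrite leq_exp2r // size_encode_instance.
- exact: uniq_rotation_queries.
- exact: size_rotation_queries.
- exact: rotation_queries_verify.
Qed.
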